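(* Let $I\subset S=K[x_1,\dots,x_n]$ be a monomial ideal generated in degree $d$. Then $I$ is linearly presented if and only if the graph $G^{(u,v)}_I$ is connected for all $u,v\in G(I)$.
   Context: $K$ is a field and $S=K[x_1,\dots,x_n]$ is the standard graded polynomial ring. $G(I)$ denotes the unique minimal set of monomial generators of $I$. For a monomial ideal $I$ generated in degree $d$, $G_I$ is the graph with vertex set $G(I)$ in which $\{u,v\}$ is an edge if and only if $\deg(\operatorname{lcm}(u,v))=d+1$. For $u,v\in G(I)$, $G^{(u,v)}_I$ is the induced subgraph of $G_I$ on the vertex set $\{w\in G(I) : w \text{ divides } \operatorname{lcm}(u,v)\}$. $I$ (generated in degree $d$) is linearly presented if its resolution is linear up to homological degree $1$, i.e. $\beta_{i,i+j}(I)=0$ for all $0\le i\le 1$ and $j>d$, where $\beta_{i,j}(I)=\dim_K\operatorname{Tor}_i^S(I,K)_j$. *)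

(* Defs.v *)
From HB Require Import structures.
From mathcomp Require Import all_boot all_order all_algebra.
From mathcomp.multinomials Require Import mpoly.

Set Implicit Arguments.
Unset Strict Implicit.
Unset Printing Implicit Defensive.

Import GRing.Theory.
Local Open Scope ring_scope.

(* S = K[x_1, ..., x_n] is {mpoly K[n]}, monomials are identified with their
   exponent vectors in 'X_{1..n}, and ideals are Prop-valued predicates on S. *)

Section MonomialIdeals.
Variables (K : fieldType) (n : nat).
Implicit Types (I : {mpoly K[n]} -> Prop) (M G : 'X_{1..n} -> Prop).

Definition ideal_of M (f : {mpoly K[n]}) : Prop :=
  exists s : seq ({mpoly K[n]} * 'X_{1..n}),
    (forall x, x \in s -> M x.2) /\ f = \sum_(x <- s) x.1 * 'X_[x.2].

Definition generates M I : Prop := forall f, I f <-> ideal_of M f.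

Definition monomial_ideal_in_degree I (d : nat) : Prop :=
  exists M, (forall m, M m -> mdeg m = d) /\ generates M I.

Definition minimal_generators I G : Prop :=
  generates G I /\
  forall M, (forall m, M m -> G m) -> generates M I -> forall m, G m -> M m.

(* G(I): the minimal set of monomial generators is unique, so this predicate
   is that set. *)
Definition mingens I (m : 'X_{1..n}) : Prop :=
  exists G, minimal_generators I G /\ G m.

End MonomialIdeals.

Section Graphs.

Definition connected_on (T : eqType) (V : T -> Prop) (e : rel T) : Prop :=
  forall x y, V x -> V y ->
    exists p, [/\ forall z, z \in p -> V z, path e x p & last x p = y].

Variables (K : fieldType) (n : nat).

Definition lcm_adj (d : nat) : rel 'X_{1..n} :=
  fun u v => mdeg (mlcm u v) == d.+1.

Definition lcm_vertices (I : {mpoly K[n]} -> Prop) (u v w : 'X_{1..n}) : Prop :=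
  mingens I w /\ (w <= mlcm u v)%MM.

End Graphs.

Section Resolutions.
Variables (K : fieldType) (n : nat).

(* Free modules of finite rank F_i = \bigoplus_a S(- shift a), with elements
   written as row vectors and maps acting by right multiplication. *)
Record free_sequence := FreeSequence {
  rk : nat -> nat;
  shift : forall i, 'I_(rk i) -> nat;
  aug : 'cV[{mpoly K[n]}]_(rk 0);
  diff : forall i, 'M[{mpoly K[n]}]_(rk i.+1, rk i)
}.

(* The maps preserve degree: the entry from a basis element of degree s to one
   of degree t is homogeneous of degree s - t (hence zero if s < t). *)
Definition graded (F : free_sequence) : Prop :=
  (forall a m, m \in msupp (aug F a 0) -> mdeg m = shift a) /\
  (forall i a b m, m \in msupp (diff F i a b) ->
     (mdeg m + shift b)%N = shift a).

(* ... -> F_1 -> F_0 -> I -> 0 is exact. *)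
Definition exact_onto (I : {mpoly K[n]} -> Prop) (F : free_sequence) : Prop :=
  [/\ forall f, I f <-> exists v : 'rV_(rk F 0), (v *m aug F) 0 0 = f,
      forall v : 'rV_(rk F 0),
        v *m aug F = 0 <-> exists w, v = w *m diff F 0
    & forall i (v : 'rV_(rk F i.+1)),
        v *m diff F i = 0 <-> exists w, v = w *m diff F i.+1].

Definition graded_free_resolution I (F : free_sequence) : Prop :=
  graded F /\ exact_onto I F.

(* The differential of F (x)_S K: reduction modulo (x_1, ..., x_n) keeps the
   constant coefficients. *)
Definition diffK (F : free_sequence) i : 'M[K]_(rk F i.+1, rk F i) :=
  map_mx (fun p : {mpoly K[n]} => p@_0%MM) (diff F i).

Definition cyclesK (F : free_sequence) i : 'M[K]_(rk F i) :=
  match i with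
  | 0 => 1%:M
  | i'.+1 => kermx (diffK F i')
  end.

(* The degree j component of F_i (x)_S K, as a row space. *)
Definition degree_part (F : free_sequence) i (j : nat) : 'M[K]_(rk F i) :=
  diag_mx (\row_a (shift a == j)%:R).

(* dim_K H_i(F (x)_S K)_j, which is dim_K Tor_i^S(I, K)_j when F is a graded
   free resolution of I. *)
Definition dim_tor (F : free_sequence) i j : nat :=
  (\rank (cyclesK F i :&: degree_part F i j)
   - \rank (diffK F i :&: degree_part F i j))%N.

(* beta_{i,j}(I) = b: by independence of Tor from the chosen resolution, it is
   enough to compute with one of them. *)
Definition betti_number (I : {mpoly K[n]} -> Prop) (i j b : nat) : Prop :=
  exists F, graded_free_resolution I F /\ dim_tor F i j = b.

Definition linearly_presented (I : {mpoly K[n]} -> Prop) (d : nat) : Prop :=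
  forall i j, (i <= 1)%N -> (d < j)%N -> betti_number I i (i + j) 0.

End Resolutions.

(* Main.v *)
(* Connectedness implies linearity: I is resolved by the complex whose i-th
   module is free on all (i+1)-tuples of generators, repetitions allowed, with
   basis elements in the multidegree of their lcm (a non-alternating Taylor
   complex); it is contracted, multidegree by multidegree, by prepending a fixed
   generator that divides the multidegree.  After tensoring with K, the boundary
   of (x, y, z) in multidegree L = lcm(u, v) telescopes along a path from u to v
   whose steps have lcm of degree d + 1 < deg L, so (u, v) is a boundary.

   Linearity implies connectedness: for a union C of connected components of the
   generators dividing L, the functional sending a syzygy z on G(I) to the
   coefficient of x^L in \sum_(x in C) z_x x vanishes, by induction on deg L.  If
   deg L > d + 1, compare the given resolution F with the free module on G(I): up
   to terms killed by the induction hypothesis the functional is the value, on a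
   degree deg L cycle of F_1 (x) K, of a functional that kills boundaries.  If u
   and v were in different components, it would not vanish on the syzygy
   (L/u) e_u - (L/v) e_v. *)

From HB Require Import structures.
Require Import Defs.
From mathcomp Require Import all_boot all_order all_algebra.
From mathcomp.multinomials Require Import mpoly.
From Stdlib Require Import Classical.

Set Implicit Arguments.
Unset Strict Implicit.
Unset Printing Implicit Defensive.

Import GRing.Theory.
Local Open Scope ring_scope.

(** * Division by monomials, and splitting a polynomial along generators *)

Section Monomials.
Variables (K : fieldType) (n : nat).
Implicit Types (p q : {mpoly K[n]}) (m l : 'X_{1..n}).

Lemma eq_lem_mdeg m l : (m <= l)%MM -> (mdeg l <= mdeg m)%N -> m = l.
Proof.
move=> le_ml; rewrite -(submK le_ml) mdegD -[X in (_ <= X)%N]add0n leq_add2r leqn0.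
by rewrite mdeg_eq0 => /eqP ->; rewrite add0m.
Qed.

Lemma lem_anti m l : (m <= l)%MM -> (l <= m)%MM -> m = l.
Proof.
move=> /mnm_lepP le_ml /mnm_lepP le_lm; apply/mnmP=> i.
by apply/anti_leq; rewrite le_ml le_lm.
Qed.

Lemma mulX_inj m : injective (fun p => p * 'X_[m]).
Proof. by move=> p q /= eq_pq; apply/mpolyP=> k; rewrite -(mcoeffMX p m) -(mcoeffMX q m) eq_pq. Qed.

Lemma mcoeffMX_ge p m l : (p * 'X_[m])@_l != 0 -> (m <= l)%MM.
Proof.
rewrite -mcoeff_msupp (perm_mem (msuppMX _ _)) => /mapP[k _ ->].
exact: lem_addr.
Qed.

Lemma mcoeffMXE p m l :
  (p * 'X_[m])@_l = if (m <= l)%MM then p@_(l - m) else 0.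
Proof.
case: ifPn => [le_ml | /negPf le'_ml].
  by rewrite -{1}(submK le_ml) [(_ + m)%MM]addmC mcoeffMX.
by apply/eqP; apply: contraFT le'_ml => /mcoeffMX_ge.
Qed.

(** Exponents are subtracted with truncation, so this is division by the monomial of [l] only when
    all monomials of [p] are multiples of it. *)
Definition divX l p := \sum_(m <- msupp p) p@_m *: 'X_[(m - l)%MM].

Lemma divXK l p : (forall m, m \in msupp p -> (l <= m)%MM) -> divX l p * 'X_[l] = p.
Proof.
move=> le_lp; rewrite [RHS]mpolyE mulr_suml !big_seq.
by apply: eq_bigr => m /le_lp ?; rewrite -scalerAl -mpolyXD submK.
Qed.

Variables (T : finType) (g : T -> 'X_{1..n}).

(** Fixing one generator for each monomial makes [part] below K-linear and lets the parts of an
    element of the ideal add up to it. *)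
Definition divisor m : option T := [pick x | (g x <= m)%MM].

Lemma divisor_le m x : divisor m = Some x -> (g x <= m)%MM.
Proof. by rewrite /divisor; case: pickP => // y ? [<-]. Qed.

Lemma divisor_ge m x : (g x <= m)%MM -> exists y, divisor m = Some y.
Proof. by rewrite /divisor; case: pickP => [y|/(_ x)->//]; exists y. Qed.

Definition part x p := \sum_(m <- msupp p | divisor m == Some x) p@_m *: 'X_[m].

Lemma mcoeff_part x p m : (part x p)@_m = p@_m *+ (divisor m == Some x).
Proof.
rewrite /part raddf_sum /= big_mkcond /=.
rewrite (eq_bigr (fun k => if k == m then p@_m *+ (divisor m == Some x) else 0)); last first.
  move=> k _; rewrite mcoeffZ mcoeffX; case: (eqVneq k m) => [->|_]; last by rewrite mulr0 if_same.
  by rewrite mulr1; case: ifP.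
rewrite -big_mkcond /=; have [m_p | m'p] := boolP (m \in msupp p).
  by rewrite (big_rem _ m_p) /= eqxx big1_seq ?addr0 // => k /andP[/eqP->]; rewrite mem_rem_uniqF.
rewrite big1_seq => [|k /andP[/eqP-> m_p]]; last by rewrite m_p in m'p.
by move: m'p; rewrite mcoeff_msupp negbK => /eqP->; rewrite mul0rn.
Qed.

Lemma part_is_linear x : linear (part x).
Proof.
move=> c p q; apply/mpolyP=> m.
by rewrite !(mcoeffD, mcoeffZ, mcoeff_part) mulrnDl mulrnAr.
Qed.
HB.instance Definition _ x :=
  GRing.isLinear.Build K {mpoly K[n]} {mpoly K[n]} _ (part x) (part_is_linear x).

Lemma sum_part p : (forall m, m \in msupp p -> exists x, (g x <= m)%MM) ->
  \sum_x part x p = p.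
Proof.
move=> dvd_p; apply/mpolyP=> m; rewrite raddf_sum /=.
under eq_bigr do rewrite mcoeff_part.
have [/dvd_p[x /divisor_ge[y ->]] | ] := boolP (m \in msupp p).
  rewrite (bigD1 y) //= eqxx big1 ?addr0 // => z /negPf.
  by rewrite eq_sym -(inj_eq Some_inj) => ->.
rewrite mcoeff_msupp negbK => /eqP->; rewrite big1 // => z _; exact: mul0rn.
Qed.

Lemma part_ge x p m : m \in msupp (part x p) -> divisor m = Some x /\ m \in msupp p.
Proof.
rewrite !mcoeff_msupp mcoeff_part.
by have [->|_] := eqVneq (divisor m) (Some x); rewrite ?eqxx.
Qed.

Definition quot x p := divX (g x) (part x p).

Lemma quotK x p : quot x p * 'X_[g x] = part x p.
Proof. by apply: divXK => m /part_ge[/divisor_le]. Qed.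

End Monomials.

Lemma ideal_ofP (K : fieldType) (n : nat) (M : 'X_{1..n} -> Prop) (f : {mpoly K[n]}) :
  ideal_of M f <-> forall m, m \in msupp f -> exists2 l, M l & (l <= m)%MM.
Proof.
split=> [[r [Mr ->]] m | dvd_f].
  rewrite mcoeff_msupp raddf_sum /=; move/eqP=> f_m; apply: NNPP => no_l; apply: f_m.
  rewrite big_seq big1 // => x /Mr Mx; apply/eqP/negPn/negP=> /mcoeffMX_ge le_xm.
  by apply: no_l; exists x.2.
rewrite [f]mpolyE; elim: (msupp f) dvd_f => [|m r IH] dvd_r.
  by exists [::]; rewrite !big_nil.
have [k k_r|q [Mq eq_q]] := IH; first by apply: dvd_r; rewrite inE k_r orbT.
have [|l Ml le_lm] := dvd_r m; first by rewrite inE eqxx.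
exists ((f@_m *: 'X_[m - l]%MM, l) :: q); split; last first.
  by rewrite !big_cons eq_q /= -scalerAl -mpolyXD submK.
by move=> x; rewrite inE => /predU1P[->|/Mq].
Qed.

(** * The complex on tuples of generators and its exactness *)

Section TupleComplex.
Variables (K : fieldType) (n : nat) (T : finType) (g : T -> 'X_{1..n}).
Implicit Types (s t : seq T).

Definition lcms s : 'X_{1..n} := foldr (fun x => mlcm (g x)) 0%MM s.

(* The coefficient of s in the alternating sum of the faces of t. *)
Fixpoint bd t s : K :=
  if t is x :: t' then
    (s == t')%:R - (if s is y :: s' then (x == y)%:R * bd t' s' else 0)
  else 0.

Lemma lcms_cons x s m : (lcms (x :: s) <= m)%MM = (g x <= m)%MM && (lcms s <= m)%MM.
Proof. exact: lem_mlcm. Qed.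

Lemma lcms_le s m : (lcms s <= m)%MM = all (fun x => (g x <= m)%MM) s.
Proof.
elim: s => [|x s IH]; last by rewrite lcms_cons IH.
by apply/mnm_lepP=> i; rewrite mnm0E.
Qed.

(** Makes the exponent [lcms t - lcms s] in [bdmx] a true difference wherever the coefficient is
    nonzero. *)
Lemma bd_dvd t s : bd t s != 0 -> (lcms s <= lcms t)%MM.
Proof.
elim: t s => [|x t IH] s /=; first by rewrite eqxx.
have [->|_] := eqVneq s t; first by rewrite lem_mlcmr.
case: s => [|y s]; first by rewrite subrr eqxx.
case: (x =P y) => [<-|_]; rewrite ?mul0r ?subrr ?eqxx // mul1r sub0r oppr_eq0 => /IH le_st.
by rewrite lcms_cons lem_mlcml (lepm_trans le_st) ?lem_mlcmr.
Qed.

Lemma sum_tuple_cons (V : nmodType) k (F : k.+1.-tuple T -> V) :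
  \sum_t F t = \sum_x \sum_(t : k.-tuple T) F [tuple of x :: t].
Proof.
rewrite pair_big /=; pose h (u : T * k.-tuple T) := [tuple of u.1 :: u.2].
rewrite (reindex h) //=; exists (fun t : k.+1.-tuple T => (thead t, [tuple of behead t])).
  by move=> [x t] _; congr (_, _); apply/val_inj.
by move=> t _; rewrite /h /= -tuple_eta.
Qed.

Lemma sum_delta k (F : seq T -> K) (t : k.-tuple T) :
  \sum_(s : k.-tuple T) (s == t :> seq T)%:R * F s = F t.
Proof.
rewrite (bigD1 t) //= eqxx mul1r big1 ?addr0 // => s.
by rewrite -(inj_eq val_inj) => /negPf->; rewrite mul0r.
Qed.

Lemma sum_bd k x (t : k.+1.-tuple T) (F : seq T -> K) :
  \sum_(s : k.+1.-tuple T) bd (x :: t) s * F s =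
  F t - \sum_(s : k.-tuple T) bd t s * F (x :: s).
Proof.
under eq_bigr do rewrite /= mulrBl.
rewrite sumrB (sum_delta F); congr (_ - _).
rewrite sum_tuple_cons /=.
rewrite (bigD1 x) //= [X in _ + X]big1 ?addr0.
  by apply: eq_bigr => s _; rewrite eqxx mul1r.
by move=> y /negPf; rewrite eq_sym => ->; rewrite big1 // => s _; rewrite !mul0r.
Qed.

(** With d(x, t) = t - (x, dt), one gets dd(x, t) = dt - dt + (x, ddt), and induction kills the last
    term. *)
Lemma bdbd k (t : k.+2.-tuple T) (r : k.-tuple T) :
  \sum_(s : k.+1.-tuple T) bd t s * bd s r = 0.
Proof.
elim: k t r => [|k IH] t r; case/tupleP: t => x t.
  rewrite (sum_bd x t (bd^~ r)) -(sum_delta (fun s => bd t s)) -sumrB big1 // => s _.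
  by rewrite (tuple0 s) (tuple0 r) /= subr0 mulr1 mul1r subrr.
apply: etrans (sum_bd x t (bd^~ r)) _; case/tupleP: r => y r /=.
under eq_bigr => s _ do
  rewrite mulrBr mulrCA [bd t s * _]mulrC [_ == tval s]eq_sym.
rewrite sumrB (sum_delta (bd t) [tuple of y :: r]) opprB addrCA subrr addr0.
by rewrite -mulr_sumr IH mulr0.
Qed.

(** [bdmx 0] ends in the single empty tuple, that is in S; the differentials of the resolution
    therefore begin with [bdmx 1]. *)
Definition bdmx k : 'M[{mpoly K[n]}]_(#|{:k.+1.-tuple T}|, #|{:k.-tuple T}|) :=
  \matrix_(a, b) let t := tval (enum_val a) in let s := tval (enum_val b) in
    bd t s *: 'X_[(lcms t - lcms s)%MM].

(* In terms of these multiples of the entries, [bdmx] acts with scalar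
   coefficients, see [weighted_bd]. *)
Definition weighted k (v : 'rV[{mpoly K[n]}]_#|{:k.-tuple T}|) (t : k.-tuple T) :=
  v 0 (enum_rank t) * 'X_[lcms t].

Lemma weighted_inj k (v w : 'rV_#|{:k.-tuple T}|) : weighted v =1 weighted w -> v = w.
Proof.
move=> eq_vw; apply/rowP=> a; rewrite -(enum_valK a).
exact: mulX_inj (eq_vw (enum_val a)).
Qed.

Lemma weighted_bd k (v : 'rV_#|{:k.+1.-tuple T}|) (s : k.-tuple T) :
  weighted (v *m bdmx k) s = \sum_(t : k.+1.-tuple T) bd t s *: weighted v t.
Proof.
rewrite /weighted mxE mulr_suml (reindex (@enum_rank _)) /=; last exact/onW_bij/enum_rank_bij.
apply: eq_bigr => t _; rewrite [bdmx _ _ _]mxE !enum_rankK /=.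
have [->|/bd_dvd le_st] := eqVneq (bd t s) 0; first by rewrite !scale0r mulr0 mul0r.
by rewrite -scalerAr -scalerAl -mulrA -mpolyXD submK.
Qed.

Lemma bdmxK k (v : 'rV_#|{:k.+2.-tuple T}|) : v *m bdmx k.+1 *m bdmx k = 0.
Proof.
apply: weighted_inj => r; rewrite weighted_bd. under eq_bigr do rewrite weighted_bd scaler_sumr.
rewrite exchange_big big1 => [|t _]; first by rewrite /weighted mxE mul0r.
under eq_bigr do rewrite scalerA mulrC.
by rewrite -scaler_suml bdbd scale0r.
Qed.

(** The contracting homotopy: each term of [weighted v t] moves to the tuple with the chosen divisor
    of its monomial in front of t, and [divX] undoes the weighting. *)
Definition cone k (v : 'rV_#|{:k.+1.-tuple T}|) : 'rV_#|{:k.+2.-tuple T}| :=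
  \row_a let t : k.+2.-tuple T := enum_val a in
    divX (lcms t) (part g (thead t) (weighted v [tuple of behead t])).

Lemma weighted_cone k (v : 'rV_#|{:k.+1.-tuple T}|) x (t : k.+1.-tuple T) :
  weighted (cone v) [tuple of x :: t] = part g x (weighted v t).
Proof.
rewrite {1}/weighted mxE enum_rankK /= theadE.
have -> : [tuple of behead (x :: t)] = t by apply/val_inj.
rewrite divXK // => m; case/part_ge => /divisor_le le_xm; rewrite lcms_cons le_xm mcoeff_msupp.
by move=> /mcoeffMX_ge.
Qed.

(** The boundary of [cone v] is v minus the cone of the boundary of v, and the latter is 0 for a
    cycle. *)
Lemma bdmx_exact k (v : 'rV_#|{:k.+1.-tuple T}|) :
  v *m bdmx k = 0 -> v = cone v *m bdmx k.+1.
Proof.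
move=> v_cycle; apply/esym/weighted_inj => s; rewrite weighted_bd.
rewrite sum_tuple_cons.
under eq_bigr => x _ do under eq_bigr => t _ do rewrite weighted_cone /= scalerBl.
(* The tuple s is nonempty, so a generator divides every monomial of [weighted v s]. *)
rewrite -[RHS](@sum_part _ _ _ g); last first.
  move=> m; rewrite mcoeff_msupp => /mcoeffMX_ge.
  by case/tupleP: s => y s; rewrite lcms_cons => /andP[]; exists y.
case/tupleP: s => y s; set s' := [tuple of y :: s].
(* The x-part of the cycle condition at the tail of s'; [part g x] commutes with the scalars
   [bd t s]. *)
have dv0 x : \sum_(t : k.+1.-tuple T) bd t s *: part g x (weighted v t) = 0.
  have /(congr1 (fun w => part g x (weighted w s))) := v_cycle.
  rewrite weighted_bd linear_sum /weighted mxE mul0r linear0 => {2}<-.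
  by apply: eq_bigr => t _; rewrite linearZ.
apply: eq_bigr => x _; rewrite sumrB [X in _ - X](_ : _ = 0); last first.
  under eq_bigr do rewrite -scalerA.
  by rewrite -scaler_sumr dv0 scaler0.
rewrite subr0 (bigD1 s') //= eqxx scale1r big1 ?addr0 // => t.
by rewrite -(inj_eq val_inj) eq_sym => /negPf/= ->; rewrite scale0r.
Qed.

Definition tuple_complex : free_sequence K n :=
  @FreeSequence K n (fun i => #|{:i.+1.-tuple T}|)
    (fun i a => mdeg (lcms (tval (enum_val a))))
    (\col_a 'X_[lcms (tval (enum_val a))]) (fun i => bdmx i.+1).

Lemma tuple_complex_graded : graded tuple_complex.
Proof.
split=> [a m | i a b m] /=; first by rewrite mxE => /mem_msuppXP <-.
rewrite mxE /= => m_ab; set t := tval _ in m_ab *; set s := tval _ in m_ab *.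
have /bd_dvd le_st : bd t s != 0.
  by apply: contraTneq m_ab => ->; rewrite scale0r msupp0.
by move/msuppZ_le/mem_msuppXP: m_ab => <-; rewrite -mdegD submK.
Qed.

Lemma mul_aug (v : 'rV_#|{:1.-tuple T}|) :
  (v *m aug tuple_complex) 0 0 = \sum_(t : 1.-tuple T) weighted v t.
Proof.
rewrite mxE (reindex (@enum_rank _)) /=; last exact/onW_bij/enum_rank_bij.
by apply: eq_bigr => t _; rewrite mxE enum_rankK.
Qed.

(** The augmentation is [bdmx 0] once the empty tuple is identified with the basis of S, so
    exactness at F_0 is another case of [bdmx_exact]. *)
Lemma mul_aug_eq0 (v : 'rV_#|{:1.-tuple T}|) :
  v *m aug tuple_complex = 0 <-> v *m bdmx 0 = 0.
Proof.
have weighted_nil (s : 0.-tuple T) : weighted (v *m bdmx 0) s = (v *m aug tuple_complex) 0 0.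
  rewrite mul_aug weighted_bd; apply: eq_bigr => t _; rewrite (tuple0 s).
  suff -> : bd t [tuple] = 1 by rewrite scale1r.
  by case/tupleP: t => x t; rewrite (tuple0 t) /= subr0.
split=> [v0 | /(congr1 (fun w => weighted w [tuple])) v0].
  by apply: weighted_inj => s; rewrite weighted_nil v0 /weighted !mxE mul0r.
by apply/matrixP=> a b; rewrite !ord1 -(weighted_nil [tuple]) [LHS]v0 /weighted !mxE mul0r.
Qed.

Variable I : {mpoly K[n]} -> Prop.
Hypothesis gen_I : generates (fun m => exists x, g x = m) I.

Lemma mem_genP f :
  I f <-> forall m, m \in msupp f -> exists x, (g x <= m)%MM.
Proof.
split=> [/gen_I/ideal_ofP dvd_f m /dvd_f[_ [x <-] ?]|dvd_f]; first by exists x.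
by apply/gen_I/ideal_ofP => m /dvd_f[x le_xm]; exists (g x) => //; exists x.
Qed.

Lemma tuple_complex_resolution : graded_free_resolution I tuple_complex.
Proof.
split; first exact: tuple_complex_graded.
split=> [f | v | i v].
- split=> [/mem_genP dvd_f | [v <-]].
    (* A preimage of f: the basis element of x receives the terms of f assigned to x, divided by
       [g x]. *)
    exists (\row_a quot g (thead (enum_val a : 1.-tuple T)) f).
    rewrite mul_aug -[RHS](sum_part dvd_f) sum_tuple_cons; apply: eq_bigr => x _.
    rewrite (big_pred1 [tuple]) => [|t]; last exact/esym/eqP/tuple0.
    by rewrite /weighted mxE enum_rankK theadE /= mlcm0 quotK.
  apply/mem_genP => m; rewrite mul_aug mcoeff_msupp raddf_sum /=.
  move/eqP=> v_m; apply: NNPP => no_x; apply: v_m; rewrite big1 // => t _.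
  apply/eqP/negPn/negP=> /mcoeffMX_ge; case/tupleP: t => x t.
  by rewrite lcms_cons => /andP[le_xm _]; apply: no_x; exists x.
- rewrite mul_aug_eq0; split=> [/bdmx_exact ? | [w ->]]; last exact: bdmxK.
  by exists (cone v).
by split=> [/bdmx_exact ? | [w ->]]; [exists (cone v) | apply: bdmxK].
Qed.
End TupleComplex.

(** * Tor of the tuple complex in homological degrees 0 and 1 *)

Section TupleComplexTor.
Variables (K : fieldType) (n d : nat) (T : finType) (g : T -> 'X_{1..n}).
Hypothesis deg_g : forall x, mdeg (g x) = d.

Local Notation F := (tuple_complex K g).

Lemma tuple_complex_tor0 j : (d < j)%N -> dim_tor F 0 j = 0%N.
Proof.
move=> lt_dj; rewrite /dim_tor [degree_part F 0 j](_ : _ = 0); first by rewrite !capmx0 mxrank0.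
apply/matrixP=> a b; rewrite !mxE /=; case: (tupleP (enum_val a)) => x t.
by rewrite (tuple0 t) /= mlcm0 deg_g (ltn_eqF lt_dj) mul0rn.
Qed.

(* The basis element (x, y), or 0 if its multidegree is not L. *)
Definition edge L (x y : T) : 'rV[K]_(rk F 1) :=
  \row_a ((tval (enum_val a) == [:: x; y]) && (lcms g [:: x; y] == L))%:R.

Lemma edge0 L x y : lcms g [:: x; y] != L -> edge L x y = 0.
Proof. by move=> /negPf neqL; apply/rowP=> a; rewrite !mxE neqL andbF. Qed.

(** Modulo the variables, the boundary of (x, y, z) keeps exactly the faces with the same lcm as the
    triple. If that lcm is L, this is the given combination; otherwise it is a proper divisor of L
    and all three edges are 0. *)
Lemma edge_triangle L x y z :
  (g x <= L)%MM -> (g y <= L)%MM -> (g z <= L)%MM ->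
  ((edge L y z - edge L x z + edge L x y)%R <= diffK F 1)%MS.
Proof.
move=> le_xL le_yL le_zL; have [eqL | neqL] := eqVneq (lcms g [:: x; y; z]) L; last first.
  have le_xyzL : (lcms g [:: x; y; z] <= L)%MM by rewrite lcms_le /= le_xL le_yL le_zL.
  have edge_eq0 u v : all (mem [:: x; y; z]) [:: u; v] -> edge L u v = 0.
    move=> /allP uv_xyz; apply: edge0; apply: contraNneq neqL => eqL.
    apply/eqP/lem_anti => //; rewrite -eqL lcms_le; apply/allP=> w /uv_xyz.
    by move: w; apply/allP; rewrite -lcms_le lepm_refl.
  rewrite !edge_eq0 /= ?inE ?eqxx ?orbT //.
  by rewrite subrr add0r sub0mx.
suff -> : edge L y z - edge L x z + edge L x y =
    row (enum_rank [tuple x; y; z]) (diffK F 1) by apply: row_sub.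
apply/rowP=> a; rewrite !mxE enum_rankK; cbv zeta.
rewrite -[tval [tuple x; y; z]]/[:: x; y; z] eqL mcoeffZ mcoeffX /=.
have edgeE s : (lcms g s <= L)%MM -> ((tval (enum_val a) == s) && (lcms g s == L))%:R =
    (tval (enum_val a) == s)%:R * (L - lcms g (tval (enum_val a)) == 0)%MM%:R :> K.
  move=> le_sL; have [->|] := eqVneq; last by rewrite mul0r.
  rewrite mul1r; congr (nat_of_bool _)%:R; apply/eqP/eqP=> [->|].
    by apply/mnmP=> i; rewrite !mnmE subnn.
  by move=> sub0; rewrite -(submK le_sL) sub0 add0m.
rewrite !edgeE ?lcms_le /= ?le_xL ?le_yL ?le_zL // -mulrBl -mulrDl; congr (_ * _).
move: {edgeE} (enum_val a); case/tupleP=> p; case/tupleP=> q s; rewrite (tuple0 s) /=.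
rewrite !eqseq_cons !eqxx !andbT subr0 mulr1.
rewrite [x == p]eq_sym; case: (p =P x) => _; last by rewrite /= subr0 mul0r subr0 addr0.
by rewrite /= mul1r opprB addrA [y == q]eq_sym addrAC.
Qed.

Hypothesis inj_g : injective g.

(** Induction along the path: if z follows x, the edge (x, z) is 0 because its lcm has degree d + 1,
    so the triangle (u, x, z) identifies (u, x) with (u, z) modulo boundaries. *)
Lemma edge_path L u p x y : mdeg L != d.+1 ->
    (g u <= L)%MM -> (g x <= L)%MM ->
    (forall m, m \in p -> (exists z, g z = m) /\ (m <= L)%MM) ->
    path (lcm_adj d) (g x) p -> last (g x) p = g y ->
  (edge L u x <= diffK F 1)%MS -> (edge L u y <= diffK F 1)%MS.
Proof.
move=> degL le_uL; elim: p x => [|m p IH] x le_xL p_gL /=.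
  by move=> _ /inj_g->.
have [[z <-] le_zL] := p_gL _ (mem_head _ _).
case/andP=> /eqP adj_xz zp last_p ux_im; apply: (IH z) => // [k k_p|].
  by apply: p_gL; rewrite inE k_p orbT.
have xz0 : edge L x z = 0.
  by apply: edge0; apply: contraNneq degL => <-; rewrite /= mlcm0 adj_xz.
have := edge_triangle le_uL le_xL le_zL; rewrite xz0 sub0r addrC => tri.
by rewrite -[edge L u z](subKr (edge L u x)) addmx_sub // eqmx_opp.
Qed.

Lemma tuple_complex_tor1 e :
    (forall u v, exists p, [/\ forall m, m \in p -> (exists z, g z = m) /\
                                 (m <= mlcm (g u) (g v))%MM,
                               path (lcm_adj d) (g u) p & last (g u) p = g v]) ->
  (d.+1 < e)%N -> dim_tor F 1 e = 0%N.
Proof.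
(* The truncated difference of ranks is 0 because every basis element of degree e is a boundary. *)
move=> conn lt_de; apply/eqP; rewrite subn_eq0; apply: mxrankS.
rewrite sub_capmx capmxSr andbT; apply: submx_trans (capmxSr _ _) _.
apply/row_subP=> a; have [/= deg_a | neq_a] := eqVneq (shift a) e; last first.
  suff -> : row a (degree_part F 1 e) = 0 by apply: sub0mx.
  by apply/rowP=> b; rewrite !mxE (negPf neq_a) mul0rn.
have [u [v def_a]] : exists u v, tval (enum_val a) = [:: u; v].
  case/tupleP: (enum_val a) => u s; case/tupleP: s => v s.
  by exists u, v; rewrite (tuple0 s).
have [p [p_uv uv_p last_p]] := conn u v.
have lcm_uv : lcms g [:: u; v] = mlcm (g u) (g v) by rewrite /= mlcm0.
have -> : row a (degree_part F 1 e) = edge (mlcm (g u) (g v)) u v.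
  apply/rowP=> b; rewrite !mxE lcm_uv eqxx andbT -def_a (inj_eq val_inj).
  by rewrite (inj_eq enum_val_inj) /= deg_a eqxx eq_sym.
rewrite def_a lcm_uv in deg_a.
apply: edge_path p_uv uv_p last_p _; rewrite ?lem_mlcml ?deg_a ?gtn_eqF //.
(* The path starts at (u, u), which is 0: its lcm has degree d < e. *)
rewrite edge0 ?sub0mx //= mlcm0; apply: contraTneq lt_de => eq_uv.
rewrite -deg_a -eq_uv -leqNgt (leq_trans _ (leqnSn d)) // -(deg_g u).
by apply: eq_leq; congr mdeg; apply/mnmP=> i; rewrite mnmE maxnn.
Qed.
End TupleComplexTor.

(** * Vanishing of the component functionals on syzygies *)

(** Nonconstant terms of f meet only coefficients of p at proper divisors of x^L. This is how the
    induction hypothesis on such divisors enters. *)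
Lemma mcoeffM_lowest (K : fieldType) n (f p : {mpoly K[n]}) L :
    (forall m, m != 0%MM -> (m <= L)%MM -> p@_(L - m) = 0) ->
  (f * p)@_L = f@_0 * p@_L.
Proof.
move=> p0; rewrite [f in LHS]mpolyE mulr_suml raddf_sum /=.
under eq_bigr => m _ do rewrite -scalerAl mulrC mcoeffZ mcoeffMXE.
have [f_0|f'0] := boolP (0%MM \in msupp f).
  rewrite (bigD1_seq _ f_0) ?msupp_uniq //= subm0 big1 ?addr0 => [|m nz_m].
    by case: ifP => // /negP[]; apply/mnm_lepP=> i; rewrite mnm0E.
  by case: ifP => [/(p0 _ nz_m)->|]; rewrite mulr0.
rewrite (memN_msupp_eq0 f'0) mul0r big1_seq // => m /= f_m.
by case: ifP => [/p0->|]; rewrite ?mulr0 //; apply: contraNneq f'0 => <-.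
Qed.

Section LinearPresentation.
Variables (K : fieldType) (n d : nat) (T : finType) (g : T -> 'X_{1..n}).
Hypotheses (deg_g : forall x, mdeg (g x) = d) (inj_g : injective g).
Variable I : {mpoly K[n]} -> Prop.
Hypothesis gen_I : generates (fun m => exists x, g x = m) I.

Definition combi (C : pred T) (z : T -> {mpoly K[n]}) := \sum_(x | C x) z x * 'X_[g x].

(** Among the generators dividing x^L, C is a union of connected components; elsewhere it is
    arbitrary. *)
Definition adj_closed L (C : pred T) :=
  forall x y, (g x <= L)%MM -> (g y <= L)%MM -> lcm_adj d (g x) (g y) -> C x = C y.

Lemma dvd_eq x y : (g x <= g y)%MM -> x = y.
Proof. by move=> le_xy; apply/inj_g/eq_lem_mdeg; rewrite ?deg_g. Qed.

(** Generators of equal degree do not divide one another, so only [z x] contributes to the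
    coefficient at [g x], through its constant term. *)
Lemma syz_const z : combi predT z = 0 -> forall x, (z x)@_0 = 0.
Proof.
move=> z0 x; transitivity (combi predT z)@_(g x); last by rewrite z0 mcoeff0.
rewrite raddf_sum (bigD1 x) //= big1 => [|y neq_yx].
  by rewrite addr0 -{1}[g x]addm0 mcoeffMX.
by rewrite mcoeffMXE; case: ifP => // /dvd_eq eq_yx; rewrite eq_yx eqxx in neq_yx.
Qed.

(** If C contains all generators dividing x^L, the coefficient is that of the full sum, which is 0;
    if it contains none, no term reaches x^L. *)
Lemma syz_constant_on L C z : combi predT z = 0 ->
    (forall x y, (g x <= L)%MM -> (g y <= L)%MM -> C x = C y) ->
  (combi C z)@_L = 0.
Proof.
move=> z0 constC; have [/existsP[x /andP[le_xL Cx]]|] :=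
    boolP [exists x, (g x <= L)%MM && C x].
  rewrite -(mcoeff0 K L) -z0 !raddf_sum /= big_mkcond /=; apply: eq_bigr => y _.
  by case: ifPn => //; rewrite mcoeffMXE; case: ifP => // /(constC _ _ le_xL)<-; rewrite Cx.
rewrite negb_exists => /forallP noC; rewrite raddf_sum big1 //= => x Cx.
by rewrite mcoeffMXE; have:= noC x; rewrite Cx andbT => /negPf->.
Qed.

(** Two distinct generators dividing x^L have an lcm of degree at least d + 1, hence exactly d + 1,
    and are adjacent; so C is constant on them. *)
Lemma syz_low_degree L C z : (mdeg L <= d.+1)%N -> adj_closed L C ->
  combi predT z = 0 -> (combi C z)@_L = 0.
Proof.
move=> degL closC z0; apply: syz_constant_on => // x y le_xL le_yL.
have [-> // | neq_xy] := eqVneq x y; apply: closC => //.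
have le_lcm : (mlcm (g x) (g y) <= L)%MM by rewrite lem_mlcm le_xL le_yL.
rewrite /lcm_adj eqn_leq (leq_trans _ degL) /=; last first.
  by rewrite -(submK le_lcm) mdegD leq_addl.
rewrite -(deg_g x) ltnNge; apply: contra neq_xy => le_deg.
have /dvd_eq-> // : (g y <= g x)%MM.
by rewrite (eq_lem_mdeg (lem_mlcml _ (g y)) le_deg) lem_mlcmr.
Qed.

Section Resolution.
Variable F : free_sequence K n.
Hypothesis resF : graded_free_resolution I F.

Lemma diff_aug : diff F 0 *m aug F = 0.
Proof.
have [_ [_ ex0 _]] := resF; apply/row_matrixP=> a; rewrite row_mul row0.
by apply/ex0; exists (delta_mx 0 a); rewrite -rowE.
Qed.

Lemma diff_diff : diff F 1 *m diff F 0 = 0.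
Proof.
have [_ [_ _ ex]] := resF; apply/row_matrixP=> a; rewrite row_mul row0.
by apply/ex; exists (delta_mx 0 a); rewrite -rowE.
Qed.

(** The subtraction in [dim_tor] is truncated, so its vanishing only bounds a rank; boundaries being
    cycles, the bound forces equality. *)
Lemma dim_tor1_eq0 e : dim_tor F 1 e = 0%N ->
  (cyclesK F 1 :&: degree_part F 1 e <= diffK F 1)%MS.
Proof.
move=> /eqP; rewrite subn_eq0.
have sub_cap : (diffK F 1 :&: degree_part F 1 e <= cyclesK F 1 :&: degree_part F 1 e)%MS.
  apply: capmxS => //; apply/sub_kermxP; rewrite /diffK -map_mxM.
  by rewrite diff_diff map_mx0.
rewrite (geq_leqif (mxrank_leqif_sup sub_cap)) => /submx_trans; apply.
exact: capmxSl.
Qed.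

Lemma diffK_graded a b : diffK F 0 a b != 0 -> shift a = shift b.
Proof.
by rewrite mxE -mcoeff_msupp; have [[_ grF] _] := resF => /grF; rewrite mdeg0 add0n.
Qed.

(* [coaug predT] is [aug F]; for general C, it is the composite of a graded
   lift F_0 -> S^T of the augmentation with z |-> combi C z. *)
Definition coaug C : 'cV[{mpoly K[n]}]_(rk F 0) :=
  \col_b combi C (fun x => quot g x (aug F b 0)).

Lemma aug_in b : I (aug F b 0).
Proof.
by have [_ [exI _ _]] := resF; apply/exI; exists (delta_mx 0 b); rewrite -rowE mxE.
Qed.

Lemma combi_quot C p : combi C (fun x => quot g x p) = \sum_(x | C x) part g x p.
Proof. by apply: eq_bigr => x _; rewrite quotK. Qed.

Lemma coaugT : coaug predT = aug F.
Proof.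
apply/colP=> b; rewrite mxE combi_quot sum_part //.
exact/(mem_genP gen_I)/aug_in.
Qed.

Definition colift (v : 'rV_(rk F 0)) x := \sum_b v 0 b * quot g x (aug F b 0).

Lemma combi_colift C v : combi C (colift v) = (v *m coaug C) 0 0.
Proof.
rewrite /combi mxE; under eq_bigr => x _ do rewrite mulr_suml.
rewrite exchange_big /=; apply: eq_bigr => b _; rewrite mxE mulr_sumr.
by apply: eq_bigr => x _; rewrite mulrA.
Qed.

Lemma mcoeff_coaug_degree C a L :
  ((row a (diff F 0) *m coaug C) 0 0)@_L != 0 -> shift a = mdeg L.
Proof.
have [[graug grdiff] _] := resF; move=> /eqP nz; apply: NNPP => neq_deg; apply: nz.
rewrite mxE raddf_sum big1 //= => b _; apply/eqP/negPn/negP.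
rewrite -mcoeff_msupp => /msuppM_le/allpairsP[[k1 k2] /= [k1_diff k2_aug def_L]].
apply: neq_deg; rewrite mxE in k1_diff; rewrite -(grdiff _ _ _ _ k1_diff) def_L mdegD.
congr (_ + _)%N; move: k2_aug; rewrite mxE combi_quot mcoeff_msupp raddf_sum /=.
move=> /eqP k2_aug; apply: NNPP => neq_deg; apply: k2_aug; rewrite big1 // => x _.
apply/eqP/negPn/negP; rewrite -mcoeff_msupp => /part_ge[_ /graug/esym].
by move/neq_deg.
Qed.

Lemma syz_vanish_step L C z : (d.+1 < mdeg L)%N -> dim_tor F 1 (mdeg L) = 0%N ->
    (forall m y, m != 0%MM -> (m <= L)%MM -> combi predT y = 0 ->
      (combi C y)@_(L - m) = 0) ->
  combi predT z = 0 -> (combi C z)@_L = 0.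
Proof.
move=> lt_dL tor0 IH z0; have [_ [exI ex0 _]] := resF.
have [A A_aug] : exists A : T -> 'rV_(rk F 0), forall x, (A x *m aug F) 0 0 = 'X_[g x].
  apply: (@fin_all_exists _ _ (fun x v => (v *m aug F) 0 0 = 'X_[g x])) => x.
  apply/exI/(mem_genP gen_I) => m /mem_msuppXP <-; exists x; exact: lepm_refl.
(* The image of z under the lift e_x -> [A x] from S^T to F_0; it lies in the kernel of [aug F]. *)
pose y := \sum_x z x *: A x.
have y_const : map_mx (mcoeff 0%MM) y = 0.
  apply/rowP=> b; rewrite !mxE summxE raddf_sum big1 //= => x _.
  by rewrite mxE rmorphM /= syz_const // mul0r.
have zL : (combi C z)@_L = ((y *m coaug C) 0 0)@_L.
  apply/eqP; rewrite -subr_eq0 -mcoeffB; apply/eqP.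
  (* The round trip S^T -> F_0 -> S^T differs from the identity by the syzygies [kappa x].
     Multiplied by [z x], which has no constant term, they contribute nothing at x^L by
     induction. *)
  pose kappa x u := (u == x)%:R - colift (A x) u.
  have kappaE B x : combi B (kappa x) = (B x)%:R * 'X_[g x] - (A x *m coaug B) 0 0.
    rewrite -combi_colift /combi; under eq_bigr => u _ do rewrite mulrBl.
    rewrite sumrB; congr (_ - _); case: (boolP (B x)) => Bx.
      rewrite (bigD1 x) //= eqxx big1 ?addr0 // => u /andP[_ /negPf->]; exact: mul0r.
    rewrite mul0r big1 // => u Bu; case: eqVneq => [eq_ux|_]; last exact: mul0r.
    by rewrite -eq_ux Bu in Bx.
  have -> : combi C z - (y *m coaug C) 0 0 = \sum_x z x * combi C (kappa x).
    under [RHS]eq_bigr do rewrite kappaE mulrBr.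
    rewrite sumrB /combi big_mkcond mulmx_suml summxE; congr (_ - _).
      by apply: eq_bigr => x _; case: (C x); rewrite ?mul1r ?mul0r ?mulr0.
    by apply: eq_bigr => x _; rewrite -scalemxAl mxE.
  rewrite raddf_sum big1 //= => x _; rewrite mcoeffM_lowest ?syz_const ?mul0r // => m nz_m le_m.
  by apply: IH => //; rewrite kappaE coaugT A_aug mul1r subrr.
(* The functional on F_1 sees only constant terms, so it descends to F_1 tensored with K. *)
have mulL (v : 'rV_(rk F 1)) : ((v *m diff F 0 *m coaug C) 0 0)@_L =
    \sum_a (v 0 a)@_0 * ((row a (diff F 0) *m coaug C) 0 0)@_L.
  rewrite -mulmxA mxE raddf_sum /=; apply: eq_bigr => a _.
  have -> : (diff F 0 *m coaug C) a 0 = (row a (diff F 0) *m coaug C) 0 0.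
    by rewrite -row_mul [RHS]mxE.
  rewrite mcoeffM_lowest // => m nz_m le_m; rewrite -combi_colift; apply: IH => //.
  by rewrite combi_colift coaugT -row_mul diff_aug row0 mxE.
have [w def_y] : exists w, y = w *m diff F 0.
  apply/ex0/matrixP=> i j; rewrite !ord1 mulmx_suml summxE [RHS]mxE -[RHS]z0.
  by apply: eq_bigr => x _; rewrite -scalemxAl mxE A_aug.
(* The part of w modulo the variables in degree [mdeg L]. It is a cycle since y has no constant term
   and [diffK F 0] preserves degree; by the vanishing of Tor it is then a boundary. *)
pose wD := map_mx (mcoeff 0%MM) w *m degree_part F 1 (mdeg L).
have wDE a : wD 0 a = (w 0 a)@_0 *+ (shift a == mdeg L).
  rewrite mxE (bigD1 a) //= big1 => [|b /negPf neq_ba]; rewrite !mxE.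
    by rewrite eqxx mulr1n mulr_natr addr0.
  by rewrite neq_ba mulr0.
have /submxP[t def_wD] : (wD <= diffK F 1)%MS.
  apply: submx_trans (dim_tor1_eq0 tor0); rewrite sub_capmx submxMl andbT.
  apply/sub_kermxP/rowP=> b; rewrite mxE [RHS]mxE.
  transitivity ((map_mx (mcoeff 0%MM) y) 0 b *+ (shift b == mdeg L)); last first.
    by rewrite y_const mxE mul0rn.
  rewrite def_y map_mxM mxE -sumrMnl; apply: eq_bigr => a _.
  rewrite wDE [map_mx _ w _ _]mxE -/(diffK F 0).
  have [->|/diffK_graded->] := eqVneq (diffK F 0 a b) 0.
    by rewrite !mulr0 mul0rn.
  by rewrite mulrnAl.
have def_wD' : map_mx (mcoeff 0%MM) (map_mx (@mpolyC n K) t *m diff F 1) = wD.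
  rewrite map_mxM -map_mx_comp def_wD; congr (_ *m _).
  by apply/rowP=> a; rewrite mxE /= mpolyCK.
(* Lifting t to constant polynomials gives a boundary in F_1, where the functional is 0 since
   consecutive differentials compose to 0. *)
have := mulL (map_mx (@mpolyC n K) t *m diff F 1).
rewrite -(mulmxA _ (diff F 1)) diff_diff mulmx0 mul0mx mxE mcoeff0 => sum0.
rewrite zL def_y mulL [RHS]sum0; apply: eq_bigr => a _.
have -> : ((map_mx (@mpolyC n K) t *m diff F 1) 0 a)@_0 = wD 0 a by rewrite -def_wD' [RHS]mxE.
rewrite wDE; have [_|neq_a] := eqVneq; first by rewrite mulr1n.
(* Coordinates of w in other degrees contribute nothing, by homogeneity. *)
rewrite mulr0n mul0r; apply/eqP; rewrite mulf_eq0; apply/orP; right.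
by apply: contraNT neq_a => /mcoeff_coaug_degree->.
Qed.

End Resolution.
Hypothesis linear_tor1 : forall e, (d.+1 < e)%N ->
  exists F, graded_free_resolution I F /\ dim_tor F 1 e = 0%N.

Lemma syz_vanish L C z : adj_closed L C -> combi predT z = 0 -> (combi C z)@_L = 0.
Proof.
have [N] := ubnP (mdeg L); elim: N L C z => // N IH L C z /ltnSE-degL closC z0.
have [le_Ld | lt_dL] := leqP (mdeg L) d.+1; first exact: syz_low_degree.
(* The resolution may change with the degree; each step of the induction uses only the one for
   [mdeg L]. *)
have [F [resF tor0]] := linear_tor1 lt_dL.
apply: (syz_vanish_step resF lt_dL tor0) => // m y nz_m le_mL.
(* Closure under adjacency passes from L to its divisor L - m. *)
apply: IH => [|a b le_a le_b]; last first.
  by apply: closC; [apply: lepm_trans le_a _ | apply: lepm_trans le_b _]; apply: lem_subr.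
apply: leq_trans degL; rewrite -{2}(submK le_mL) mdegD -addn1 leq_add2l.
by rewrite lt0n mdeg_eq0.
Qed.

Definition adj_below L : rel T :=
  fun x y => [&& (g x <= L)%MM, (g y <= L)%MM & lcm_adj d (g x) (g y)].

Lemma connect_below L x y : (g x <= L)%MM -> (g y <= L)%MM -> connect (adj_below L) x y.
Proof.
move=> le_xL le_yL; apply/negPn/negP => not_xy.
pose z u : {mpoly K[n]} := (u == x)%:R * 'X_[(L - g x)%MM] - (u == y)%:R * 'X_[(L - g y)%MM].
(* Only the membership of x and y in C matters: the value is 0 for [predT] and x^L for the component
   of x. *)
have combiE (C : pred T) : combi C z = ((C x)%:R - (C y)%:R) * 'X_[L].
  have delta w : (g w <= L)%MM ->
      \sum_(u | C u) (u == w)%:R * 'X_[(L - g w)%MM] * 'X_[g u] = (C w)%:R * 'X_[L] :> {mpoly K[n]}.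
    move=> le_wL; case: (boolP (C w)) => Cw.
      rewrite (bigD1 w) //= eqxx big1 => [|u /andP[_ /negPf->]]; last by rewrite !mul0r.
      by rewrite addr0 !mul1r -mpolyXD submK.
    rewrite mul0r big1 // => u Cu; case: eqVneq => [eq_uw|]; last by rewrite !mul0r.
    by rewrite -eq_uw Cu in Cw.
  by rewrite mulrBl -!delta // -sumrB; apply: eq_bigr => u _; rewrite mulrBl.
have closC : adj_closed L (connect (adj_below L) x).
  move=> a b le_aL le_bL adj_ab.
  apply/idP/idP => /connect_trans; apply; apply: connect1; apply/and3P; split=> //.
  by move: adj_ab; rewrite /lcm_adj mlcmC.
have /(syz_vanish closC)/eqP : combi predT z = 0 by rewrite combiE subrr mul0r.
by rewrite combiE connect0 (negPf not_xy) subr0 mul1r mcoeffX eqxx oner_eq0.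
Qed.
End LinearPresentation.

(** * Uniqueness and finiteness of the minimal generators *)

Section MinimalGenerators.
Variables (K : fieldType) (n d : nat) (I : {mpoly K[n]} -> Prop) (M : 'X_{1..n} -> Prop).
Hypotheses (deg_M : forall m, M m -> mdeg m = d) (gen_M : generates M I).

Lemma generates_dvd G m : generates G I -> M m -> exists2 l, G l & (l <= m)%MM.
Proof.
move=> gen_G Mm; suff /gen_G/ideal_ofP/(_ m) : I 'X_[m] by apply; apply/mem_msuppXP.
by apply/gen_M/ideal_ofP => _ /mem_msuppXP <-; exists m; rewrite ?lepm_refl.
Qed.

Lemma generates_sub G m : (forall l, G l -> M l) -> generates G I -> M m -> G m.
Proof.
move=> subG gen_G Mm; have [l Gl le_lm] := generates_dvd gen_G Mm.
by rewrite -(eq_lem_mdeg le_lm) // (deg_M Mm) (deg_M (subG _ Gl)).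
Qed.

(** If G generates I and l is in M, some k in G divides l and some j in M divides k; equal degrees
    give j = l, hence k = l. So M is contained in G, and minimality of G gives the converse. *)
Lemma mingensE m : mingens I m <-> M m.
Proof.
split=> [[G [[gen_G min_G] Gm]] | Mm]; last first.
  exists M; do 2!split=> //; move=> G subG gen_G l; exact: generates_sub subG gen_G.
have subM l : M l -> G l.
  move=> Ml; have [k Gk le_kl] := generates_dvd gen_G Ml.
  have /gen_M/ideal_ofP/(_ k) : I 'X_[k].
    by apply/gen_G/ideal_ofP => _ /mem_msuppXP <-; exists k; rewrite ?lepm_refl.
  case=> [|j Mj le_jk]; first exact/mem_msuppXP.
  have eq_jl : j = l.
    by apply: eq_lem_mdeg (lepm_trans le_jk le_kl) _; rewrite (deg_M Mj) (deg_M Ml).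
  by rewrite -eq_jl in le_kl *; rewrite (lem_anti le_jk le_kl).
exact: min_G Gm.
Qed.

(** There are finitely many monomials of degree at most d; selecting those in M, a mere [Prop],
    takes excluded middle. *)
Lemma finite_generators : exists2 s : seq 'X_{1..n}, uniq s & forall m, m \in s <-> M m.
Proof.
have [s sM] : exists s : seq 'X_{1..n}, forall m,
    m \in s <-> m \in map val (enum {: 'X_{1..n < d.+1}}) /\ M m.
  elim: (map _ _) => [|k r [s sM]]; first by exists [::] => m; split=> [|[]].
  have [Mk | M'k] := classic (M k); [exists (k :: s) | exists s] => m.
    by rewrite !inE; case: eqVneq => [->|_] //=.
  rewrite inE; split=> [/sM[-> Mm]|[/predU1P[-> //|r_m] Mm]]; last exact/sM.
  by rewrite orbT.
exists (undup s) => [|m]; first exact: undup_uniq.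
rewrite mem_undup sM; split=> [[]//|Mm]; split=> //.
have lt_md : (mdeg m < d.+1)%N by rewrite (deg_M Mm).
by apply/mapP; exists (BMultinom lt_md); rewrite ?mem_enum.
Qed.
End MinimalGenerators.

(** * The equivalence *)

Theorem proposition1p1 (K : fieldType) (n d : nat) (I : {mpoly K[n]} -> Prop)
    (hI : monomial_ideal_in_degree I d) :
  linearly_presented I d <->
  (forall u v : 'X_{1..n}, mingens I u -> mingens I v ->
     connected_on (lcm_vertices I u v) (lcm_adj d)).
Proof.
have [M [deg_M gen_M]] := hI; have genE := mingensE deg_M gen_M.
have [s uniq_s sE] := finite_generators deg_M.
(* The generators are indexed by a finite type, over which the tuple complex and [connect] are
   defined. *)
pose g (x : seq_sub s) : 'X_{1..n} := ssval x.
have gM x : M (g x) by apply/sE/ssvalP.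
have Mg m : M m -> exists x, g x = m by move=> /sE s_m; exists (SeqSub s_m).
have deg_g x : mdeg (g x) = d by apply: deg_M.
have inj_g : injective g by apply: val_inj.
have gen_I : generates (fun m => exists x, g x = m) I.
  move=> f; rewrite gen_M !ideal_ofP; split=> dvd_f m /dvd_f[l].
    by move=> Ml le_lm; exists l => //; apply: Mg.
  by case=> x <- le_xm; exists (g x).
split=> [linI u v Gu Gv x y [/genE/Mg[a <-] le_a] [/genE/Mg[b <-] le_b] | connI].
  have linear_tor1 e : (d.+1 < e)%N ->
      exists F, graded_free_resolution I F /\ dim_tor F 1 e = 0%N.
    (* The degree e is 1 + j with j > d, as in the condition for i = 1. *)
    by case: e => // e lt_de; apply: linI.
  have /connectP[p p_ab ->] := connect_below deg_g inj_g gen_I linear_tor1 le_a le_b.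
  exists (map g p); split; last by rewrite last_map.
    move=> _ /mapP[c p_c ->]; split; first exact/genE.
    elim: p a {le_a} p_ab p_c => //= c' p IH a /andP[/and3P[_ le_c _] p_c'].
    by rewrite inE => /predU1P[->//|]; apply: IH p_c'.
  rewrite path_map; apply: sub_path p_ab => c c'; by case/and3P.
have resF := tuple_complex_resolution gen_I.
case=> [|[|i]] // j _ lt_dj; exists (tuple_complex K g); split=> //.
  exact: (tuple_complex_tor0 _ deg_g).
apply: (tuple_complex_tor1 _ deg_g inj_g) => // u v.
have Gg x : mingens I (g x) by apply/genE.
have [||p [p_uv uv_p last_p]] := connI _ _ (Gg u) (Gg v) (g u) (g v).
- by split; rewrite ?lem_mlcml.
- by split; rewrite ?lem_mlcmr.
by exists p; split=> // m /p_uv[/genE/Mg].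
Qed.
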